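(* Let $n\geq 2$ be an integer and define $$R_n(u):=u\prod_{i=1}^{\lfloor n/2\rfloor}\left(1+\varepsilon^{4i-3}u\right)^2-(\varepsilon+u)^2\prod_{i=2}^{\lceil n/2\rceil}\left(1+\varepsilon^{4i-5}u\right)^2 ,$$ a polynomial in $u$ of degree $n+1$. Let $p$ be a prime. Then $R_n$ has exactly $n+1$ roots in $\mathbb{R}_+$, $\mathbb{Q}_p^*$, or $\mathbb{F}_p((t))^*$, according as $\varepsilon$ is $1/4$, $p$, or $t$. In particular, for these choices of $\varepsilon$, all the roots of $R_n$ have generalized phase $1$.
   Context: An empty product equals $1$. $\mathbb{R}_+$ is the set of positive real numbers. Generalized phase: for $y\in\mathbb{R}^*$, $\phi(y):=y/|y|$. For $L=\mathbb{Q}_p$ or $\mathbb{F}_p((t))$, let $\rho=p$ or $\rho=t$ respectively, let $\mathfrak{M}$ be the maximal ideal (generated by $\rho$) of the ring of integers of $L$, and let $\mathrm{ord}$ be the valuation with $\mathrm{ord}\,\rho=1$; then for $y\in L^*$, $\phi(y):=\frac{y}{\rho^{\mathrm{ord}\,y}}\bmod\mathfrak{M}$. *)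

(* Defs.v *)
From HB Require Import structures.
From mathcomp Require Import all_boot all_order all_algebra fraction.
From mathcomp Require Import boolp classical_sets cardinality reals.

Set Implicit Arguments.
Unset Strict Implicit.
Unset Printing Implicit Defensive.

Import Order.TTheory GRing.Theory Num.Theory.
Local Open Scope ring_scope.
Local Open Scope classical_set_scope.

(* Classical inverse operation, used to view the rings below as
   [comUnitRingType]s. *)
Section ClassicalInverse.
Variable A : comNzRingType.

Definition cunit : {pred A} := fun x => `[< exists y, y * x = 1 >].

Definition cinv (x : A) : A :=
  if pselect (exists y, y * x = 1) is left e then projT1 (cid e) else x.

Lemma cmulVx : {in cunit, left_inverse 1 cinv *%R}.
Proof.
move=> x /asboolP ex; rewrite /cinv; case: pselect => // e.
exact: (projT2 (cid e)).
Qed.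

Lemma cunitPl (x y : A) : y * x = 1 -> cunit x.
Proof. by move=> yx; apply/asboolP; exists y. Qed.

Lemma cinv_out : {in [predC cunit], cinv =1 id}.
Proof. by move=> x /asboolP nex; rewrite /cinv; case: pselect. Qed.

End ClassicalInverse.

(* The ring Z_p, as the inverse limit of the rings Z / p^n. The n-th component
   is represented by its remainder modulo p^n: the compatibility condition
   forces 0 <= a n < p^n, so that equality is equality of sequences. *)
Record padic_int (p : nat) (p_pr : prime p) := PadicInt {
  padic_seq :> nat -> int;
  padic_seqP : forall n, (padic_seq n.+1 %% (p ^ n)%N)%Z = padic_seq n }.

Section PadicInt.
Variables (p : nat) (p_pr : prime p).
Local Notation Z_p := (padic_int p_pr).

HB.instance Definition _ := gen_eqMixin Z_p.
HB.instance Definition _ := gen_choiceMixin Z_p.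

Lemma padic_eq (a b : Z_p) : (forall n, a n = b n) -> a = b.
Proof.
case: a b => [a aP] [b bP] /= /funext ab; case: _ / ab in bP *.
by congr PadicInt; apply: Prop_irrelevance.
Qed.

Lemma padic_mod (a : Z_p) n : (a n %% (p ^ n)%N)%Z = a n.
Proof. by rewrite -padic_seqP modz_mod. Qed.

Lemma modz_expS n (m : int) :
  ((m %% (p ^ n.+1)%N)%Z %% (p ^ n)%N)%Z = (m %% (p ^ n)%N)%Z.
Proof.
by rewrite [in RHS](divz_eq m (p ^ n.+1)%N) expnS PoszM mulrA modzMDl.
Qed.

Fact padic_add_subproof (a b : Z_p) n :
  (((a n.+1 + b n.+1)%R %% (p ^ n.+1)%N)%Z %% (p ^ n)%N)%Z
  = ((a n + b n)%R %% (p ^ n)%N)%Z.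
Proof. by rewrite modz_expS -modzDm !padic_seqP. Qed.
Definition padic_add a b := PadicInt p_pr (padic_add_subproof a b).

Fact padic_mul_subproof (a b : Z_p) n :
  (((a n.+1 * b n.+1)%R %% (p ^ n.+1)%N)%Z %% (p ^ n)%N)%Z
  = ((a n * b n)%R %% (p ^ n)%N)%Z.
Proof. by rewrite modz_expS -modzMm !padic_seqP. Qed.
Definition padic_mul a b := PadicInt p_pr (padic_mul_subproof a b).

Fact padic_opp_subproof (a : Z_p) n :
  (((- a n.+1)%R %% (p ^ n.+1)%N)%Z %% (p ^ n)%N)%Z
  = ((- a n)%R %% (p ^ n)%N)%Z.
Proof. by rewrite modz_expS -modzNm padic_seqP. Qed.
Definition padic_opp a := PadicInt p_pr (padic_opp_subproof a).

Fact padic_of_int_subproof (m : int) n :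
  ((m %% (p ^ n.+1)%N)%Z %% (p ^ n)%N)%Z = (m %% (p ^ n)%N)%Z.
Proof. exact: modz_expS. Qed.
Definition padic_of_int m := PadicInt p_pr (padic_of_int_subproof m).

Fact padic_addA : associative padic_add.
Proof.
by move=> a b c; apply: padic_eq => n /=; rewrite modzDmr modzDml addrA.
Qed.

Fact padic_addC : commutative padic_add.
Proof. by move=> a b; apply: padic_eq => n /=; rewrite addrC. Qed.

Fact padic_add0 : left_id (padic_of_int 0) padic_add.
Proof. by move=> a; apply: padic_eq => n /=; rewrite mod0z add0r padic_mod. Qed.

Fact padic_addN : left_inverse (padic_of_int 0) padic_opp padic_add.
Proof. by move=> a; apply: padic_eq => n /=; rewrite modzDml addNr. Qed.

HB.instance Definition _ := GRing.isZmodule.Build Z_p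
  padic_addA padic_addC padic_add0 padic_addN.

Fact padic_mulA : associative padic_mul.
Proof.
by move=> a b c; apply: padic_eq => n /=; rewrite modzMmr modzMml mulrA.
Qed.

Fact padic_mulC : commutative padic_mul.
Proof. by move=> a b; apply: padic_eq => n /=; rewrite mulrC. Qed.

Fact padic_mul1 : left_id (padic_of_int 1) padic_mul.
Proof.
by move=> a; apply: padic_eq => n /=; rewrite modzMml mul1r padic_mod.
Qed.

Fact padic_mulDl : left_distributive padic_mul padic_add.
Proof.
move=> a b c; apply: padic_eq => n /=.
by rewrite modzMml mulrDl modzDmr modzDml.
Qed.

Fact padic_one_neq0 : padic_of_int 1 != 0.
Proof.
apply/eqP => /(congr1 (fun a : Z_p => a 1%N)) /=.
by rewrite mod0z expn1 modz_small //= ltz_nat prime_gt1.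
Qed.

HB.instance Definition _ := GRing.Zmodule_isComNzRing.Build Z_p
  padic_mulA padic_mulC padic_mul1 padic_mulDl padic_one_neq0.

HB.instance Definition _ := GRing.ComNzRing_hasMulInverse.Build Z_p
  (@cmulVx Z_p) (@cunitPl Z_p) (@cinv_out Z_p).

Lemma padic_mod_le (a : Z_p) m n : (m <= n)%N -> (a n %% (p ^ m)%N)%Z = a m.
Proof.
elim: n => [|n IHn]; first by rewrite leqn0 => /eqP->; rewrite padic_mod.
rewrite leq_eqVlt => /orP[/eqP->|]; first exact: padic_mod.
rewrite ltnS => mn; rewrite -(IHn mn) -(padic_seqP a n).
have /dvdnP[k ->] : (p ^ m %| p ^ n)%N by rewrite dvdn_exp2l.
by rewrite [in LHS](divz_eq (a n.+1) (k * p ^ m)%N) PoszM mulrA modzMDl.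
Qed.

Lemma padic_neq0 (a : Z_p) : a != 0 -> exists n, a n != 0.
Proof.
move=> a0; apply: contrapT => /forallNP an; case/eqP: a0; apply: padic_eq => n.
by rewrite [RHS]mod0z; apply/eqP/negPn/negP/an.
Qed.

Fact padic_integral : GRing.integral_domain_axiom Z_p.
Proof.
move=> a b ab0; apply/norP => -[/padic_neq0[m am] /padic_neq0[n bn]].
have ndvd (c : Z_p) k l : c k != 0 -> (k <= l)%N ->
    (0 < `|c l|)%N /\ (logn p `|c l| < k)%N.
  move=> ck kl; have : ~~ (p ^ k %| `|c l|)%N.
    apply: contra ck => dv; rewrite -(padic_mod_le c kl).
    by apply/eqP/dvdz_mod0P.
  have [->|cl0] := posnP `|c l|%N; first by rewrite dvdn0.
  by rewrite pfactor_dvdn // -ltnNge.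
have [a_gt0 av] := ndvd a m (m + n)%N am (leq_addr _ _).
have [b_gt0 bv] := ndvd b n (m + n)%N bn (leq_addl _ _).
have /(congr1 (fun c : Z_p => c (m + n)%N)) /= := ab0.
rewrite mod0z => /dvdz_mod0P; rewrite dvdzE abszM pfactor_dvdn //; last first.
  by rewrite muln_gt0 a_gt0.
by rewrite lognM // leqNgt -addnS leq_add // ltnW.
Qed.

HB.instance Definition _ := GRing.ComUnitRing_isIntegral.Build Z_p
  padic_integral.

End PadicInt.

Record power_series (F : fieldType) := PowerSeries { pscoef :> nat -> F }.

Section PowerSeries.
Variable F : fieldType.
Local Notation series := (power_series F).

HB.instance Definition _ := gen_eqMixin series.
HB.instance Definition _ := gen_choiceMixin series.

Lemma ps_eq (a b : series) : (forall n, a n = b n) -> a = b.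
Proof. by case: a b => [a] [b] /= /funext->. Qed.

Definition ps_add (a b : series) := PowerSeries (fun n => a n + b n).
Definition ps_opp (a : series) := PowerSeries (fun n => - a n).
Definition ps_mul (a b : series) :=
  PowerSeries (fun n => \sum_(i < n.+1) a i * b (n - i)%N).
Definition ps_monomial k : series := PowerSeries (fun n => (n == k)%:R).

Fact ps_addA : associative ps_add.
Proof. by move=> a b c; apply: ps_eq => n /=; rewrite addrA. Qed.

Fact ps_addC : commutative ps_add.
Proof. by move=> a b; apply: ps_eq => n /=; rewrite addrC. Qed.

Fact ps_add0 : left_id (PowerSeries (fun=> 0)) ps_add.
Proof. by move=> a; apply: ps_eq => n /=; rewrite add0r. Qed.

Fact ps_addN : left_inverse (PowerSeries (fun=> 0)) ps_opp ps_add.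
Proof. by move=> a; apply: ps_eq => n /=; rewrite addNr. Qed.

HB.instance Definition _ := GRing.isZmodule.Build series
  ps_addA ps_addC ps_add0 ps_addN.

Let tr n (a : series) : {poly F} := \poly_(i < n.+1) a i.

Let ps_mulE (a b : series) m n : (m <= n)%N ->
  ps_mul a b m = (tr n a * tr n b)`_m.
Proof.
move=> mn; rewrite coefM; apply: eq_bigr => -[i] /=; rewrite ltnS => im _.
by rewrite !coef_poly !ltnS (leq_trans im mn) (leq_trans (leq_subr _ _) mn).
Qed.

Fact ps_mulC : commutative ps_mul.
Proof. by move=> a b; apply: ps_eq => n; rewrite !(@ps_mulE _ _ n n) // mulrC. Qed.

Fact ps_mulA : associative ps_mul.
Proof.
move=> a b c; apply: ps_eq => n; rewrite !(@ps_mulE _ _ n n) //.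
transitivity (tr n a * (tr n b * tr n c))`_n; last rewrite mulrA.
  rewrite !coefM; apply: eq_bigr => i _; congr (_ * _).
  by rewrite coef_poly ltnS leq_subr (@ps_mulE _ _ _ n) // leq_subr.
rewrite !coefM; apply: eq_bigr => -[i] /=; rewrite ltnS => im _.
by congr (_ * _); rewrite [RHS]coef_poly ltnS im (@ps_mulE _ _ _ n).
Qed.

Fact ps_mul1 : left_id (ps_monomial 0) ps_mul.
Proof.
move=> a; apply: ps_eq => n /=; rewrite big_ord_recl /= subn0 mul1r.
by rewrite big1 ?addr0 // => i _; rewrite mul0r.
Qed.

Fact ps_mulDl : left_distributive ps_mul ps_add.
Proof.
move=> a b c; apply: ps_eq => n /=; rewrite -big_split /=.
by apply: eq_bigr => i _; rewrite mulrDl.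
Qed.

Fact ps_one_neq0 : ps_monomial 0 != 0.
Proof.
apply/eqP => /(congr1 (fun a : series => a 0%N)) /= /eqP.
by rewrite oner_eq0.
Qed.

HB.instance Definition _ := GRing.Zmodule_isComNzRing.Build series
  ps_mulA ps_mulC ps_mul1 ps_mulDl ps_one_neq0.

HB.instance Definition _ := GRing.ComNzRing_hasMulInverse.Build series
  (@cmulVx series) (@cunitPl series) (@cinv_out series).

Lemma ps_neq0 (a : series) : a != 0 ->
  exists2 n, a n != 0 & forall m, (m < n)%N -> a m = 0.
Proof.
move=> a0; have [|n an nmin] := @ex_minnP (fun n => a n != 0).
  apply: contrapT => /forallNP an; case/eqP: a0; apply: ps_eq => n.
  by apply/eqP/negPn/negP/an.
exists n => // m mn; apply/eqP; apply: contraTT mn => /nmin.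
by rewrite -leqNgt.
Qed.

Fact ps_integral : GRing.integral_domain_axiom series.
Proof.
move=> a b ab0; apply/norP => -[/ps_neq0[m am a0] /ps_neq0[n bn b0]].
have /(congr1 (fun c : series => c (m + n)%N)) /= := ab0.
have mlt : (m < (m + n).+1)%N by rewrite ltnS leq_addr.
rewrite (bigD1 (Ordinal mlt)) //= addKn big1 => [|i im].
  by rewrite addr0 => /eqP; rewrite mulf_eq0 (negPf am) (negPf bn).
have [im'|] := ltnP i m; first by rewrite a0 // mul0r.
rewrite leq_eqVlt => /orP[/eqP mi|mi].
  by case/eqP: im; apply: val_inj; rewrite /= -mi.
by rewrite [b _]b0 ?mulr0 // ltn_subLR ?ltn_add2r // -ltnS.
Qed.

HB.instance Definition _ := GRing.ComUnitRing_isIntegral.Build series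
  ps_integral.

End PowerSeries.

Definition padic (p : nat) (p_pr : prime p) : fieldType :=
  {fraction (padic_int p_pr)}.

Definition laurent (F : fieldType) : fieldType := {fraction (power_series F)}.

Definition laurentX (F : fieldType) : laurent F :=
  FracField.tofrac (ps_monomial F 1).

Definition real_phase (R : realType) (y : R) : R := y / `|y|.

(* The valuation and the generalized phase on a field L with ring of integers
   O, whose maximal ideal is generated by rho. *)
Section Phase.
Variables (L : fieldType) (O : set L) (rho : L).

Definition max_ideal : set L := [set rho * a | a in O].

(* The largest k such that y belongs to rho^k O. *)
Definition ord (y : L) : int :=
  xget 0 [set k : int | O (y / rho ^ k) /\ ~ O (y / rho ^ (k + 1))].

(* The class of x modulo the maximal ideal, as a coset. *)
Definition residue (x : L) : set L := [set z | max_ideal (z - x)].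

Definition phase (y : L) : set L := residue (y / rho ^ ord y).

End Phase.

Definition padic_integers (p : nat) (p_pr : prime p) : set (padic p_pr) :=
  range (@FracField.tofrac (padic_int p_pr)).
Arguments padic_integers {p} p_pr _.

Definition laurent_integers (F : fieldType) : set (laurent F) :=
  range (@FracField.tofrac (power_series F)).
Arguments laurent_integers F _ : clear implicits.

Definition Rpoly (L : fieldType) (eps : L) (n : nat) : {poly L} :=
  'X * \prod_(1 <= i < (n./2).+1) (1 + (eps ^+ (4 * i - 3)) *: 'X) ^+ 2
  - (eps%:P + 'X) ^+ 2
    * \prod_(2 <= i < (uphalf n).+1) (1 + (eps ^+ (4 * i - 5)) *: 'X) ^+ 2.

(* Main.v *)
(* With f_j := 1 + eps^(2j-3) u one has
     R_n(u) = u * (prod_(j <= n even) f_j)^2 - eps^2 * (prod_(j <= n odd) f_j)^2.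
   In the two nonarchimedean cases, substituting u = eps^(2-2l) v with
   0 <= l <= n makes each f_j, up to a power of eps, congruent modulo eps to
   v if j <= l and to 1 if j > l; R_n then becomes, up to a power of eps and a
   sign, a function congruent to v^(l+1) - v^l, which by Hensel's argument has
   a root v = 1 mod eps. The n+1 roots so obtained have distinct valuations,
   hence are all the roots. In the real case, R_n changes sign between any two
   consecutive nodes u = eps^(3-2m), 0 <= m <= n+1: there f_j = 1 + eps^(2(j-m)),
   and u * (prod even)^2 = eps^2 * (prod odd)^2 would hold, as 4 eps = 1, if the
   product of the factors (1 + eps^(2|j-m|))^(+-1) over j <> m were 1; this
   alternating product lies on the side of 1 given by the parity of m. (At the
   extreme nodes the middle factor f_m = 2 is missing, which only helps.) *)
Require Import Defs.
From mathcomp Require Import all_boot all_order all_algebra fraction.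
From mathcomp Require Import boolp classical_sets cardinality reals.
From mathcomp Require Import polyrcf.
From mathcomp Require Import zify ring lra.

Set Implicit Arguments.
Unset Strict Implicit.
Unset Printing Implicit Defensive.

Import Order.TTheory GRing.Theory Num.Theory.
Local Open Scope ring_scope.
Local Open Scope classical_set_scope.
Local Open Scope card_scope.

(** * Counting roots, and the degree of $R_n$ *)

(** A root outside the family would give [N + 1] distinct roots in degree [N]. *)
Lemma all_roots_in_family (L : fieldType) (P : {poly L}) (N : nat) (r : nat -> L) :
  size P = N.+1 -> {in gtn N &, injective r} ->
  (forall k, (k < N)%N -> root P (r k)) ->
  forall u, root P u -> exists2 k, (k < N)%N & u = r k.
Proof.
move=> sP rI rP u Pu; have [/mapP[k]|uN] := boolP (u \in map r (iota 0 N)).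
  by rewrite mem_iota add0n => kN ->; exists k.
have P0 : P != 0 by rewrite -size_poly_gt0 sP.
suff /(max_poly_roots P0) : all (root P) (u :: map r (iota 0 N)).
  rewrite /= uN map_inj_in_uniq ?iota_uniq ?size_map ?size_iota => [/(_ isT)|].
    by rewrite sP ltnn.
  by move=> i j; rewrite !mem_iota => ? ?; apply: rI.
rewrite /= Pu; apply/allP => _ /mapP[k + ->]; rewrite mem_iota; exact: rP.
Qed.

Lemma card_roots_family (L : fieldType) (P : {poly L}) (N : nat) (r : nat -> L)
    (C : set L) :
  size P = N.+1 -> {in gtn N &, injective r} ->
  (forall k, (k < N)%N -> root P (r k)) -> (forall k, (k < N)%N -> C (r k)) ->
  [set u | C u /\ root P u] #= `I_N.
Proof.
move=> sP rI rP rC.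
have -> : [set u | C u /\ root P u] = r @` `I_N.
  apply/seteqP; split=> [u [_]|_ [k kN <-]]; last by split; [exact: rC|exact: rP].
  by case/(all_roots_in_family sP rI rP) => k kN ->; exists k.
apply: inj_card_eq => i j; rewrite !inE; exact: rI.
Qed.

Lemma size_prod_sqr (L : fieldType) (F : nat -> {poly L}) m n :
  (forall i, size (F i) = 2) ->
  size (\prod_(m <= i < n) F i ^+ 2) = ((n - m).*2).+1.
Proof.
move=> sF; have F0 i : F i != 0 by rewrite -size_poly_gt0 sF.
have [nm|mn] := leqP n m; first by rewrite big_geq // size_poly1; lia.
rewrite -(subnKC (ltnW mn)); elim: (n - m)%N => [|k IHk].
  by rewrite addn0 big_geq // size_poly1 subnn.
rewrite addnS big_nat_recr ?leq_addr //= expr2.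
have Q0 : \prod_(m <= i < m + k) F i ^+ 2 != 0.
  by rewrite -size_poly_gt0 IHk.
rewrite size_mul ?mulf_neq0 // size_mul // !sF IHk; lia.
Qed.

(** The two terms have degrees $2\lfloor n/2\rfloor+1$ and $2\lceil n/2\rceil$, which are [n] and
    [n + 1] in an order given by the parity of [n]; the leading terms cannot cancel. *)
Lemma size_Rpoly (L : fieldType) (eps : L) n :
  eps != 0 -> (0 < n)%N -> size (Rpoly eps n) = n.+2.
Proof.
move=> e0 n0.
have sC (c : L) : c != 0 -> size (1 + c *: 'X : {poly L}) = 2%N.
  by move=> c0; rewrite addrC size_polyDl size_scale // ?size_polyX ?size_poly1.
have sF (h : nat -> nat) i : size (1 + eps ^+ h i *: 'X : {poly L}) = 2%N.
  by rewrite sC // expf_neq0.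
rewrite /Rpoly; set A := \prod_(1 <= i < _) _; set B := \prod_(2 <= i < _) _.
have sA : size A = n./2.*2.+1.
  by rewrite (size_prod_sqr _ _ (sF (fun i => 4 * i - 3)%N)) subSS subn0.
have sB : size B = (uphalf n).-1.*2.+1.
  by rewrite (size_prod_sqr _ _ (sF (fun i => 4 * i - 5)%N)); lia.
have A0 : A != 0 by rewrite -size_poly_gt0 sA.
have B0 : B != 0 by rewrite -size_poly_gt0 sB.
have sX : size (eps%:P + 'X) = 2 by rewrite addrC size_XaddC.
have X0 : eps%:P + 'X != 0 by rewrite -size_poly_gt0 sX.
have sA' : size ('X * A) = n./2.*2.+2 by rewrite mulrC size_mulX // sA.
have sB' : size ((eps%:P + 'X) ^+ 2 * B) = (uphalf n).*2.+1.
  rewrite expr2 size_mul ?mulf_neq0 // size_mul // sX sB.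
  by case: n n0 {A B sA sB A0 B0 sA'} => // n _ /=; lia.
have := odd_double_half n; have := uphalf_half n.
case: (odd n) => /= u h.
  by rewrite addrC size_polyDl ?size_polyN ?sB' ?sA'; lia.
by rewrite size_polyDl ?size_polyN ?sB' ?sA'; lia.
Qed.

(* The product of the factors 1 + eps^(2j-3) u over the 1 <= j <= n such that
   [odd j = c]; splitting off j = 1 exchanges the two parities and replaces
   u by eps^2 u. *)
Fixpoint altprod (L : fieldType) (eps : L) (c : bool) (n : nat) (u : L) : L :=
  if n is m.+1 then
    (if c then 1 + eps^-1 * u else 1) * altprod eps (~~ c) m (eps ^+ 2 * u)
  else 1.

(** For [j = 2i - 1] the exponent [2j - 3 = 4i - 5] is negative at [i = 1]; hence the form
    [4 * i - 4] with a separate [eps^-1]. *)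
Lemma altprodE (L : fieldType) (eps : L) n u : eps != 0 ->
  altprod eps false n u = \prod_(1 <= i < n./2.+1) (1 + eps ^+ (4 * i - 3) * u) /\
  altprod eps true n u
  = \prod_(1 <= i < (uphalf n).+1) (1 + eps ^+ (4 * i - 4) * (eps^-1 * u)).
Proof.
move=> e0; elim: n u => [|n IHn] u; first by rewrite /= !big_geq.
have [IHf IHt] := IHn (eps ^+ 2 * u).
rewrite [altprod _ _ n.+1 _]/= [altprod _ true n.+1 _]/= IHf IHt mul1r.
rewrite -[n.+1./2]/(uphalf n) -[uphalf n.+1]/(n./2.+1); split.
  apply: eq_big_nat => i /andP[i1 _]; congr (1 + _).
  have -> : (4 * i - 3 = (4 * i - 4) + 1)%N by lia.
  by rewrite exprD; move: (4 * i - 4)%N => k; field.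
rewrite [RHS]big_nat_recl //= expr0 mul1r; congr (_ * _).
apply: eq_big_nat => i /andP[i1 _]; congr (1 + _).
have -> : (4 * i.+1 - 4 = (4 * i - 3) + 3)%N by lia.
by rewrite exprD; move: (4 * i - 3)%N => k; field.
Qed.

(** The factor $(\varepsilon+u)^2$ is $\varepsilon^2$ times the square of the first odd factor
    $1+u/\varepsilon$. *)
Lemma Rpoly_altprod (L : fieldType) (eps : L) n u : eps != 0 -> (0 < n)%N ->
  (Rpoly eps n).[u]
  = u * altprod eps false n u ^+ 2 - eps ^+ 2 * altprod eps true n u ^+ 2.
Proof.
move=> e0 n0.
have [-> ->] := altprodE n u e0; rewrite /Rpoly hornerD hornerN 2!hornerM.
rewrite horner_exp hornerD hornerC !hornerX !horner_prod -!prodrXl; congr (_ * _ - _).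
  by apply: eq_bigr => i _; rewrite !hornerE.
have u0 : (0 < uphalf n)%N by case: n n0.
rewrite [in RHS]big_ltn // expr0 mul1r mulrA -exprMn; congr (_ * _).
  by congr (_ ^+ 2); field.
apply: eq_big_nat => i /andP[i2 _]; rewrite !hornerE; congr ((1 + _) ^+ 2).
have -> : (4 * i - 4 = (4 * i - 5) + 1)%N by lia.
by rewrite exprD; move: (4 * i - 5)%N => k /=; field.
Qed.

(** * Hensel's argument over a complete domain, covering both nonarchimedean cases *)

Definition adically_complete (O : idomainType) (rho : O) : Prop :=
  [/\ rho != 0,
      forall y, rho * y <> 1,
      forall x, (forall n, exists c, x = rho ^+ n * c) -> x = 0
    & forall x : nat -> O,
        (forall n, exists c, x n.+1 - x n = rho ^+ n * c) ->
        exists y, forall n, exists c, y - x n = rho ^+ n * c].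

Section AdicallyComplete.
Variables (O : idomainType) (rho : O) (L : fieldType) (emb : {rmorphism O -> L}).
Hypothesis emb_inj : injective emb.
Hypothesis rho_complete : adically_complete rho.

Let rho_neq0 : rho != 0. Proof. by case: rho_complete. Qed.
Local Notation eps := (emb rho).
Local Notation integers := (range emb).

Let eps_neq0 : eps != 0. Proof. by rewrite -(rmorph0 emb) inj_eq. Qed.

(* The iteration x |-> x - phi x contracts. *)
Lemma root_of_near_identity (phi : O -> O) :
  (forall x y, exists c, phi x - phi y = (x - y) * (1 + rho * c)) ->
  exists x, phi x = 0.
Proof.
case: rho_complete => _ _ sep complete phiP.
pose x := fix x n := if n is m.+1 then x m - phi (x m) else 0.
have [|y yP] := complete x.
  elim=> [|n [c xc]]; first by exists (x 1%N - x 0%N); rewrite mul1r.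
  have [d] := phiP (x n.+1) (x n); rewrite xc => /eqP.
  rewrite subr_eq => /eqP e.
  exists (- (c * d)); rewrite [x n.+2]/= -/(x n.+1) e.
  have -> : phi (x n) = - (x n.+1 - x n) by rewrite /=; ring.
  by rewrite xc exprS; ring.
(* By separation it suffices that every [rho ^+ n] divides [phi y]: it divides both
   [phi y - phi (x n)] and [phi (x n) = x n - x n.+1]. *)
exists y; apply: sep => n.
have [c yc] := yP n; have [c' yc'] := yP n.+1; have [d] := phiP y (x n).
rewrite yc => /eqP; rewrite subr_eq => /eqP ->.
exists (c * (1 + rho * d) + (rho * c' - c)).
have -> : phi (x n) = (y - x n.+1) - (y - x n) by rewrite /=; ring.
by rewrite yc yc' exprS; ring.
Qed.

(* In the coordinate x of v = 1 + rho x, the function g agrees to first order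
   modulo rho with v^k. *)
Definition jet (k : nat) (g : O -> O) : Prop :=
  (forall x, exists c, g x = 1 + rho * c) /\
  (forall x y, exists c, g x - g y = rho * (x - y) * (k%:R + rho * c)).

Lemma jetM k l g h : jet k g -> jet l h -> jet (k + l) (fun x => g x * h x).
Proof.
move=> [g1 gD] [h1 hD]; split=> [x|x y].
  have [c ->] := g1 x; have [d ->] := h1 x.
  by exists (c + d + rho * c * d); ring.
have [a ga] := g1 x; have [b hb] := h1 y.
have [c gc] := gD x y; have [d hd] := hD x y.
exists (d + a * l%:R + rho * a * d + c + b * k%:R + rho * b * c).
have -> : g x * h x - g y * h y = g x * (h x - h y) + (g x - g y) * h y by ring.
by rewrite gc hd ga hb natrD; ring.
Qed.

Lemma jet_cst : jet 0 (fun=> 1).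
Proof. by split=> [x|x y]; exists 0; ring. Qed.

Lemma jet_shift s : jet 1 (fun x => rho ^+ s.+1 + (1 + rho * x)).
Proof.
split=> [x|x y]; first by exists (rho ^+ s + x); rewrite exprS; ring.
by exists 0; ring.
Qed.

Lemma jet_small s : jet 0 (fun x => 1 + rho ^+ s.+1 * (1 + rho * x)).
Proof.
split=> [x|x y]; first by exists (rho ^+ s * (1 + rho * x)); rewrite exprS; ring.
by exists (rho ^+ s); rewrite exprS; ring.
Qed.

(** The quotient [(g - h) / rho] has slope [k.+1 - k = 1] modulo [rho], whatever the residue
    characteristic, so it has a zero. *)
Lemma jet_meet k g h : jet k.+1 g -> jet k h -> exists x, g x = h x.
Proof.
move=> [g1 gD] [h1 hD].
have /choice[phi phiP] : forall x, exists w, g x - h x = rho * w.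
  move=> x; have [c ->] := g1 x; have [d ->] := h1 x.
  by exists (c - d); ring.
have [|x phi0] := @root_of_near_identity phi; last first.
  by exists x; apply/eqP; rewrite -subr_eq0 phiP phi0 mulr0.
move=> x y; have [c gc] := gD x y; have [d hd] := hD x y.
exists (c - d); apply: (mulfI rho_neq0); rewrite mulrBr -!phiP.
have -> : g x - h x - (g y - h y) = (g x - g y) - (h x - h y) by ring.
by rewrite gc hd -natr1; ring.
Qed.

(** This treats the factors with [j > l]: each is 1 plus a multiple of [eps], and passing to
    [eps ^+ 2 * u] only raises [s]. *)
Lemma altprod_jet0 c n s : exists2 e, jet 0 e &
  forall x, altprod eps c n (eps ^+ s.+2 * emb (1 + rho * x)) = emb (e x).
Proof.
elim: n c s => [|n IHn] c s.
  by exists (fun=> 1) => [|x]; [exact: jet_cst|rewrite rmorph1].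
have [e je eP] := IHn (~~ c) s.+2.
exists (fun x => (if c then 1 + rho ^+ s.+1 * (1 + rho * x) else 1) * e x).
  by rewrite -[0%N]addn0; apply: jetM je; case: c {eP};
    [exact: jet_small|exact: jet_cst].
move=> x; rewrite /= [eps ^+ 2 * _]mulrA -exprD add2n eP [RHS]rmorphM; congr (_ * _).
case: c {eP}; rewrite ?rmorph1 //; move: (1 + rho * x) => v.
rewrite rmorphD rmorph1 rmorphM rmorphXn; congr (1 + _).
by rewrite exprS mulrA mulKf.
Qed.

(** Each factor with [j <= l] contributes one [v = 1 + rho * x] once its power of [eps] is cleared.
    The two clearing exponents differ by exactly [l], which compensates the power of [eps] in
    [u]. *)
Lemma altprod_jet n l : (l <= n)%N -> exists M ef et,
  [/\ jet l./2 ef, jet (uphalf l) et &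
   forall x, let u := eps ^+ 2 / eps ^+ l.*2 * emb (1 + rho * x) in
     eps ^+ M * altprod eps false n u = emb (ef x) /\
     eps ^+ (M + l) * altprod eps true n u = emb (et x)].
Proof.
elim: l n => [|l IHl] [|n] // ln.
- exists 0%N, (fun=> 1), (fun=> 1); split=> [||x /=].
  + exact: jet_cst.
  + exact: jet_cst.
  + by rewrite rmorph1 mulr1.
- have [ef jf fP] := altprod_jet0 false n.+1 0.
  have [et jt tP] := altprod_jet0 true n.+1 0.
  exists 0%N, ef, et; split=> // x u.
  by rewrite !mul1r -fP -tP /u expr0 divr1.
- have [M [ef [et [jf jt eP]]]] := IHl n ln.
  (* The parities are exchanged: the new even product is the old odd one, while the new odd product
     gains [f_1], equal to $v+\varepsilon^{2l+1}$ after multiplication by $\varepsilon^{2l+1}$. *)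
  exists (M + l)%N, et, (fun x => (rho ^+ l.*2.+1 + (1 + rho * x)) * ef x).
  split=> // [|x u].
    by rewrite -[uphalf l.+1]/(1 + l./2)%N; apply: jetM jf; exact: jet_shift.
  have [fP tP] := eP x.
  have e2 : eps ^+ l.+1.*2 = eps ^+ 2 * eps ^+ l.*2 by rewrite -exprD.
  have eu : eps ^+ 2 * u = eps ^+ 2 / eps ^+ l.*2 * emb (1 + rho * x).
    rewrite /u e2; move: (emb (1 + _)) (eps ^+ l.*2) (expf_neq0 l.*2 eps_neq0).
    move: eps eps_neq0 => e e0 v c c0.
    by field; rewrite e0 c0.
  rewrite [altprod _ false n.+1 _]/= [altprod _ true n.+1 _]/= eu mul1r tP.
  split=> //; rewrite [RHS]rmorphM -fP {eP fP tP eu}.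
  move: (altprod _ _ _ _) => a; rewrite /u {u}; move: (1 + rho * x) => v.
  rewrite rmorphD rmorphXn e2.
  have -> : (M + l + l.+1 = M + l.*2.+1)%N by lia.
  rewrite exprD exprS; move: (emb v) (eps ^+ M) => {v} v b.
  have := expf_neq0 l.*2 eps_neq0; move: (eps ^+ l.*2) => c.
  by move: eps eps_neq0 a v b => e e0 a v b c0; field; rewrite e0 c0.
Qed.

Lemma Rpoly_root_near n l : (0 < n)%N -> (l <= n)%N ->
  exists x, root (Rpoly eps n) (eps ^ (2 - l.*2%:Z) * emb (1 + rho * x)).
Proof.
move=> n0 ln; have [M [ef [et [jf jt eP]]]] := altprod_jet ln.
have jv : jet 1 (fun x => 1 + rho * x).
  by split=> [x|x y]; [exists x|exists 0; ring].
have jA := jetM jv (jetM jf jf); have jB := jetM jt jt.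
(* The jets of the two sides are [l] and [l + 1] for odd [l], and [l + 1] and [l] for even [l]. *)
have [x xP] : exists x, (1 + rho * x) * (ef x * ef x) = et x * et x.
  have := uphalf_half l; case: (odd l) => /= lE.
    rewrite (_ : _ + _ = (1 + (l./2 + l./2)).+1)%N in jB; last by lia.
    by have [x xP] := jet_meet jB jA; exists x.
  rewrite (_ : 1 + _ = (uphalf l + uphalf l).+1)%N in jA; last by lia.
  exact: jet_meet jA jB.
exists x; have [] := eP x; rewrite /= -/(_ ^+ 2).
have -> : eps ^ (2 - l.*2%:Z) = eps ^+ 2 / eps ^+ l.*2 by rewrite expfzDr // -invr_expz.
set u := _ * emb _ => fP tP.
rewrite /root Rpoly_altprod //.
have E0 : eps ^+ (M + l) ^+ 2 != 0 by rewrite !expf_neq0.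
rewrite -(mulrI_eq0 _ (mulfI E0)); apply/eqP.
transitivity (eps ^+ 2 * (emb (1 + rho * x) * (eps ^+ M * altprod eps false n u) ^+ 2
   - (eps ^+ (M + l) * altprod eps true n u) ^+ 2)).
  move: (altprod _ false _ _) (altprod _ true _ _) => a b.
  rewrite /u -addnn !exprD; move: (emb (1 + _)) => c.
  by field; rewrite expf_neq0.
by rewrite fP tP -!rmorphXn -rmorphM !expr2 xP subrr mulr0.
Qed.

Lemma integersP (x : L) : integers x <-> exists a, x = emb a.
Proof. by split=> [[a _ <-]|[a ->]]; exists a. Qed.

(** Dividing by [eps ^ m] with [m > k] leaves the integers: otherwise [rho] would divide
    [1 + rho * x], hence 1. *)
Lemma ord_near_unit (k : int) x :
  ord integers eps (eps ^ k * emb (1 + rho * x)) = k.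
Proof.
have rhoNunit : forall y, rho * y <> 1 by case: rho_complete.
set v := 1 + rho * x.
have powE (m : int) : (eps ^ k * emb v) / eps ^ m = eps ^ (k - m) * emb v.
  by rewrite expfzDr // -invr_expz mulrAC.
have in_int (m : int) : integers (eps ^ k * emb v / eps ^ m) <-> (m <= k).
  rewrite powE; split=> [/integersP[a]|mk].
    rewrite leNgt => /eqP e; apply/negP => km; move: e.
    have -> : k - m = - (`|m - k|.-1.+1)%N%:Z by lia.
    rewrite -invr_expz -(inj_eq (mulfI (expf_neq0 `|m - k|.-1.+1 eps_neq0))).
    rewrite mulVKf ?expf_neq0 //.
    rewrite -rmorphXn -rmorphM (inj_eq emb_inj) => /eqP e.
    apply: (rhoNunit (rho ^+ `|m - k|.-1 * a - x)).
    by rewrite mulrBr mulrA -exprS -e /v; ring.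
  apply/integersP; exists (rho ^+ `|k - m| * v).
  by rewrite rmorphM rmorphXn -[in LHS](@gez0_abs (k - m)) ?subr_ge0.
rewrite /ord; case: xgetP => [m _ [/in_int mk]|/(_ k) []].
  by rewrite in_int => /negP; lia.
by split; [apply/in_int|rewrite in_int; lia].
Qed.

Lemma phase_near_unit (k : int) x :
  phase integers eps (eps ^ k * emb (1 + rho * x)) = residue integers eps 1.
Proof.
rewrite /phase ord_near_unit mulrAC divff ?expfz_neq0 // mul1r.
rewrite rmorphD rmorphM rmorph1 /residue /max_ideal.
apply/seteqP; split=> z /= [_ [a _ <-]].
  move=> e; exists (emb (a + x)); first by exists (a + x).
  by rewrite rmorphD mulrDr e; ring.
move=> e; exists (emb (a - x)); first by exists (a - x).
by rewrite rmorphB mulrBr e; ring.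
Qed.

Lemma Rpoly_roots_adic n : (0 < n)%N ->
  [/\ size (Rpoly eps n) = n.+2,
      [set u | u <> 0 /\ root (Rpoly eps n) u] #= `I_n.+1
    & forall u, root (Rpoly eps n) u ->
        phase integers eps u = residue integers eps 1].
Proof.
move=> n0; have sP := size_Rpoly eps_neq0 n0.
have /choice[x xP] : forall l, exists x, (l <= n)%N ->
    root (Rpoly eps n) (eps ^ (2 - l.*2%:Z) * emb (1 + rho * x)).
  move=> l; have [ln|_] := leqP l n; last by exists 0.
  by have [x xP] := Rpoly_root_near n0 ln; exists x.
pose r l := eps ^ (2 - l.*2%:Z) * emb (1 + rho * x l).
have rI : {in gtn n.+1 &, injective r}.
  move=> i j _ _ /(congr1 (ord integers eps)); rewrite !ord_near_unit; lia.
split=> //.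
  apply: (card_roots_family sP rI xP) => l _ /eqP; rewrite mulf_eq0.
  rewrite (negPf (expfz_neq0 _ eps_neq0)) -(rmorph0 emb) (inj_eq emb_inj) => /eqP e.
  case: rho_complete => _ /(_ (- x l)) + _ _; apply.
  by rewrite mulrN; apply/eqP; rewrite eqr_oppLR -addr_eq0 addrC e.
by move=> u /(all_roots_in_family sP rI xP)[l _ ->]; exact: phase_near_unit.
Qed.

End AdicallyComplete.

(** * Completeness of the [p]-adic integers *)

Section PadicComplete.
Variables (p : nat) (p_pr : prime p).
Local Notation Z_p := (padic_int p_pr).

Let p_gt0 n : (0 < p ^ n)%N. Proof. by rewrite expn_gt0 prime_gt0. Qed.

Lemma padic_natr m : m%:R = padic_of_int p_pr m.
Proof.
elim: m => [//|m IHm]; rewrite mulrS IHm; apply: padic_eq => n /=.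
by rewrite modzDm -PoszD.
Qed.

Lemma padic_pX k : (p%:R : Z_p) ^+ k = padic_of_int p_pr (p ^ k)%N.
Proof. by rewrite -natrX padic_natr. Qed.

Lemma padic_pXM_coef k (c : Z_p) : (p%:R ^+ k * c) k = 0.
Proof. by rewrite padic_pX /= modzMml modzMr. Qed.

Lemma padic_subE (x y : Z_p) n : (x - y) n = ((x n - y n) %% (p ^ n)%N)%Z.
Proof. by rewrite /= modzDmr. Qed.

(** Division by [p ^ k] loses [k] digits, so component [n] of the quotient is read off component
    [k + n] of [x]. *)
Lemma padic_dvd_pX k (x : Z_p) : x k = 0 -> exists c, x = p%:R ^+ k * c.
Proof.
move=> xk.
have xE n : x (k + n)%N = (p ^ k)%N%:Z * (x (k + n)%N %/ (p ^ k)%N)%Z.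
  rewrite mulrC divzK //; apply/dvdz_mod0P.
  by rewrite padic_mod_le ?leq_addr.
have cP n : ((x (k + n.+1)%N %/ (p ^ k)%N)%Z %% (p ^ n)%N)%Z
    = (x (k + n)%N %/ (p ^ k)%N)%Z.
  have pk0 : (p ^ k)%N%:Z != 0 by rewrite -lt0n.
  apply: (mulfI pk0); rewrite -xE mulz_modr ?ltz_nat // -xE -PoszM -expnD.
  by rewrite padic_mod_le // leq_add2l.
exists (PadicInt p_pr cP); apply: padic_eq => n.
by rewrite padic_pX /= modzMml -xE padic_mod_le ?leq_addl.
Qed.

Lemma padic_complete : adically_complete (p%:R : Z_p).
Proof.
split.
(* Component 1 of [p] is already 0; component 2 is the first to detect it. *)
- apply/eqP => /(congr1 (fun a : Z_p => a 2%N)).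
  rewrite padic_natr /= mod0z modz_small ?lez_nat //=; last first.
    by rewrite ltz_nat -{1}[p]expn1 ltn_exp2l ?prime_gt1.
  by case=> p0; move: (prime_gt0 p_pr); rewrite p0.
- move=> y /(congr1 (fun a : Z_p => a 1%N)).
  rewrite -[p%:R]expr1 padic_pXM_coef /= expn1 modz_small //=.
  by rewrite ltz_nat prime_gt1.
- move=> x xP; apply: padic_eq => n; have [c ->] := xP n.
  by rewrite padic_pXM_coef [RHS]mod0z.
- move=> x xP.
  (* The limit is the diagonal [x n n]. *)
  have yP n : (x n.+1 n.+1 %% (p ^ n)%N)%Z = x n n.
    rewrite padic_seqP; have [c /(congr1 (fun a : Z_p => a n))] := xP n.
    rewrite padic_pXM_coef padic_subE => /dvdz_mod0P; rewrite -eqz_mod_dvd.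
    by rewrite !padic_mod => /eqP.
  exists (PadicInt p_pr yP) => n; apply: padic_dvd_pX.
  by rewrite padic_subE /= subrr mod0z.
Qed.

End PadicComplete.

(** * Completeness of the power series ring *)

Section PowerSeriesComplete.
Variable F : fieldType.
Local Notation series := (power_series F).
Local Notation t := (ps_monomial F 1).

Lemma ps_monomialM k (c : series) n :
  (ps_monomial F k * c) n = if (n < k)%N then 0 else c (n - k)%N.
Proof.
rewrite -[LHS]/(\sum_(i < n.+1) (i == k :> nat)%:R * c (n - i)%N).
have [nk|kn] := ltnP n k.
  by rewrite big1 // => i _; rewrite ltn_eqF ?mul0r //; case: i => /= i; lia.
have kn' : (k < n.+1)%N by [].
rewrite (bigD1 (Ordinal kn')) //= eqxx mul1r big1 ?addr0 // => i ik.
by rewrite -[k]/(val (Ordinal kn')) val_eqE (negPf ik) mul0r.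
Qed.

Lemma ps_monomialX k : t ^+ k = ps_monomial F k.
Proof.
elim: k => [//|k IHk]; rewrite exprS IHk; apply: ps_eq => -[|n].
  by rewrite ps_monomialM.
by rewrite ps_monomialM /= subn1 eqSS.
Qed.

Lemma ps_dvd_X k (x : series) :
  (forall n, (n < k)%N -> x n = 0) -> exists c, x = t ^+ k * c.
Proof.
move=> xk; exists (PowerSeries (fun n => x (n + k)%N)); apply: ps_eq => n.
rewrite ps_monomialX ps_monomialM; have [/xk//|kn] := ltnP n k.
by rewrite /= subnK.
Qed.

Lemma ps_complete : adically_complete t.
Proof.
split.
- apply/eqP => /(congr1 (fun a : series => a 1%N)) /= /eqP.
  by rewrite oner_eq0.
- move=> y /(congr1 (fun a : series => a 0%N)); rewrite ps_monomialM /= => /eqP.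
  by rewrite eq_sym oner_eq0.
- move=> x xP; apply: ps_eq => n; have [c ->] := xP n.+1.
  by rewrite ps_monomialX ps_monomialM ltnS leqnn.
(* Congruence modulo [t ^+ n] leaves coefficient [n] free, so this coefficient is stable only from
   [x n.+1] on. *)
- move=> x xP; exists (PowerSeries (fun n => x n.+1 n)) => n.
  apply: ps_dvd_X => m mn; rewrite -[LHS]/(x m.+1 m - x n m).
  apply/eqP; rewrite subr_eq0 eq_sym; apply/eqP; rewrite -(subnKC mn).
  elim: (n - m.+1)%N => [|d <-]; first by rewrite addn0.
  have [c /(congr1 (fun a : series => a m))] := xP (m.+1 + d)%N.
  rewrite ps_monomialX ps_monomialM ifT ?ltn_addr // => /eqP.
  by rewrite addnS -[X in X == _]/(x _ m - x _ m) subr_eq0 => /eqP.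
Qed.

End PowerSeriesComplete.

(** * The real case: sign changes at the nodes *)

Section Real.
Variable R : rcfType.
Local Notation eps := (4^-1 : R).
Local Notation node m := (eps ^+ 3 / (eps ^+ m) ^+ 2).

Let eps_neq0 : eps != 0. Proof. by rewrite invr_eq0 pnatr_eq0. Qed.

Lemma altprod_gt0 c n (u : R) : 0 < u -> 0 < altprod eps c n u.
Proof.
elim: n c u => //= n IHn c u u0; apply: mulr_gt0; last by apply: IHn; lra.
by case: c => //; lra.
Qed.

(** The factors [f_j] decrease and exceed 1: pairing [f_1] with [f_2], [f_3] with [f_4], and so on
    gives the first bound; setting [f_1] aside and pairing [f_2] with [f_3] onwards gives the
    second. *)
Lemma altprod_le n (u : R) : 0 < u ->
  altprod eps false n u <= altprod eps true n u
    <= (1 + eps^-1 * u) * altprod eps false n u.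
Proof.
elim: n u => [|n IHn] u u0 /=; first lra.
have qu0 : 0 < eps ^+ 2 * u by lra.
have /andP[le1 le2] := IHn _ qu0; have f0 := altprod_gt0 false n qu0.
apply/andP; split; last by rewrite !mul1r ler_pM2l //; lra.
rewrite mul1r (le_trans le2) // ler_pM2r //; lra.
Qed.

Lemma altprod_lt n (u : R) : 0 < u ->
  altprod eps false n.+1 u < altprod eps true n.+1 u.
Proof.
move=> u0; have qu0 : 0 < eps ^+ 2 * u by lra.
have /andP[le1 le2] := altprod_le n qu0; have f0 := altprod_gt0 false n qu0.
by rewrite /= mul1r (le_lt_trans le2) // ltr_pM2r //; lra.
Qed.

Lemma node_gt0 m : 0 < node m.
Proof. by rewrite divr_gt0 ?exprn_gt0 ?invr_gt0 ?ltr0n. Qed.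

Lemma nodeS m : eps ^+ 2 * node m.+1 = node m.
Proof.
have : 0 < eps ^+ m by apply: exprn_gt0; lra.
by rewrite [eps ^+ m.+1]exprS; move: (eps ^+ m) => K K0; field; lra.
Qed.

(** The sign of $R_n$ at the node is that of [f - 2 * K * g]. For odd [m] the induction carries the
    spare factor $1+16K^2=1+\varepsilon^{2m}$, which comes from [f_1] and yields strictness at the
    next step. Equality does occur for [m = 0], [n = 1]. *)
Lemma altprod_node n m : (m <= n)%N ->
  let K := eps ^+ m.+1 in
  let f := altprod eps false n (node m.+1) in
  let g := altprod eps true n (node m.+1) in
  if odd m then (1 + 16 * K ^+ 2) * f <= 2 * K * g : Prop
  else 2 * K * g <= f /\ (n != 1%N -> 2 * K * g < f).
Proof.
rewrite /=; elim: m n => [|m IHm] [|n] // mn.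
- rewrite /= expr1; lra.
- have u0 := node_gt0 0; rewrite [altprod _ false n.+1 _]/= [altprod _ true n.+1 _]/=.
  rewrite nodeS mul1r.
  have -> : 1 + eps^-1 * node 1 = 2 by field.
  rewrite expr1 /= eqSS; have /andP[le1 _] := altprod_le n u0; split; first lra.
  by case: n {mn le1} => // n _; have := altprod_lt n u0; lra.
- have := IHm n mn; have K0 : 0 < eps ^+ m.+1 by apply: exprn_gt0; lra.
  have u0 := node_gt0 m.+1.
  rewrite [altprod _ false n.+1 _]/= [altprod _ true n.+1 _]/= nodeS mul1r.
  have := altprod_gt0 false n u0; have := altprod_gt0 true n u0.
  have -> : 1 + eps^-1 * node m.+2 = 1 + (eps ^+ m.+1) ^- 2.
    by rewrite [eps ^+ m.+2]exprS; move: (eps ^+ m.+1) K0 => K K0; field; lra.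
  rewrite [eps ^+ m.+2]exprS.
  move: (altprod _ false _ _) (altprod _ true _ _) => f g g0 f0.
  move: (eps ^+ m.+1) K0 => K K0.
  have -> : 2 * (eps * K) * ((1 + K ^- 2) * f) = (K ^+ 2 + 1) * f / (2 * K).
    by field; lra.
  have K20 : 0 < K ^+ 2 by rewrite exprn_gt0.
  rewrite /=; case: (odd m) => /= H.
    (* Strict because the hypothesis has [1 + 16 * K ^+ 2] where only [1 + K ^+ 2] is required. *)
    suff : (K ^+ 2 + 1) * f / (2 * K) < g by move=> lt; split=> [|_] //; exact: ltW.
    rewrite ltr_pdivrMr; last lra.
    have : 0 < K ^+ 2 * f by exact: mulr_gt0.
    lra.
  rewrite ler_pdivlMr; last lra.
  have : 0 <= (1 + K ^+ 2) * (f - 2 * K * g) by apply: mulr_ge0; lra.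
  lra.
Qed.

Lemma Rpoly_node_sign n m : (2 <= n)%N -> (m <= n.+1)%N ->
  if odd m then 0 < (Rpoly eps n).[node m] else (Rpoly eps n).[node m] < 0.
Proof.
move=> n2 mn; rewrite Rpoly_altprod ?eps_neq0 //; last lia.
have u0 := node_gt0 m; have K0 : 0 < eps ^+ m by apply: exprn_gt0; lra.
have f0 := altprod_gt0 false n u0; have g0 := altprod_gt0 true n u0.
have sgn : if odd m
    then 2 * eps ^+ m * altprod eps true n (node m) < altprod eps false n (node m)
    else altprod eps false n (node m) < 2 * eps ^+ m * altprod eps true n (node m).
  (* At node 0, outside the range of [altprod_node], [K = 1] and [f <= g < 2 * g]. *)
  case: m mn u0 K0 f0 g0 => [|m] mn u0 K0 f0 g0.
    by rewrite /= expr0; have /andP[] := altprod_le n u0; rewrite expr0; lra.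
  have := @altprod_node n m mn; rewrite /=; case: (odd m) => /=; last first.
    by case=> _; apply; lia.
  move: (altprod _ false _ _) (altprod _ true _ _) f0 g0 => f g f0 g0.
  move: (eps ^+ m.+1) K0 => K K0; have K20 : 0 < K ^+ 2 by rewrite exprn_gt0.
  have : 0 < K ^+ 2 * f by exact: mulr_gt0.
  lra.
move: (altprod _ false _ _) (altprod _ true _ _) f0 g0 sgn => f g f0 g0.
move: (eps ^+ m) K0 => K K0 sgn.
(* Here [4 * eps = 1] enters: $\varepsilon^2=(\varepsilon^3/K^2)(2K)^2$, so a difference of squares
   factors. *)
have -> : eps ^+ 3 / K ^+ 2 * f ^+ 2 - eps ^+ 2 * g ^+ 2
    = (f - 2 * K * g) * ((f + 2 * K * g) / (64 * K ^+ 2)).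
  by field; lra.
have Kg0 : 0 < K * g by exact: mulr_gt0.
have c0 : 0 < (f + 2 * K * g) / (64 * K ^+ 2).
  by rewrite divr_gt0 ?mulr_gt0 ?exprn_gt0 //; lra.
case: (odd m) sgn => sgn; first by rewrite pmulr_lgt0 // subr_gt0.
by rewrite pmulr_llt0 // subr_lt0.
Qed.

Lemma node_lt m n : (m < n)%N -> node m < node n.
Proof.
elim: n => // n IHn; rewrite ltnS leq_eqVlt => mn.
have le : node n < node n.+1 by rewrite -nodeS; have := node_gt0 n.+1; lra.
by case/orP: mn => [/eqP->//|/IHn/lt_trans]; apply.
Qed.

Lemma Rpoly_roots_real n : (2 <= n)%N -> let P := Rpoly eps n in
  [/\ size P = n.+2,
      [set u : R | 0 < u /\ root P u] #= `I_n.+1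
    & forall u : R, root P u -> 0 < u].
Proof.
move=> n2 P; have sP : size P = n.+2 by rewrite size_Rpoly ?eps_neq0 //; last lia.
have /choice[r rP] : forall m, exists x, (m < n.+1)%N ->
    node m < x < node m.+1 /\ root P x.
  move=> m; have [mn|_] := ltnP m n.+1; last by exists 0.
  have lt := ltW (node_lt (leqnn m.+1)).
  have [|x] := @poly_ivtoo R P _ _ lt.
    have := Rpoly_node_sign n2 (ltnW mn); have := Rpoly_node_sign n2 mn.
    rewrite /=; case: (odd m) => /= s1 s2; first by rewrite pmulr_rlt0.
    by rewrite nmulr_rlt0.
  by rewrite in_itv /= => xm Px; exists x.
have rI : {in gtn n.+1 &, injective r}.
  (* The roots lie in successive disjoint open intervals between nodes. *)
  have rlt i j : (i < j)%N -> (j < n.+1)%N -> r i < r j.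
    move=> ij jn; have [/andP[_ ri] _] := rP i (ltn_trans ij jn).
    have [/andP[rj _] _] := rP j jn; apply: (lt_trans ri); apply: le_lt_trans rj.
    move: ij; rewrite leq_eqVlt => /orP[/eqP->//|/node_lt]; exact: ltW.
  move=> i j; rewrite -!topredE /= => ni nj rij.
  have [ij|ji|//] := ltngtP i j; first by have := rlt _ _ ij nj; rewrite rij ltxx.
  by have := rlt _ _ ji ni; rewrite rij ltxx.
have rr k : (k < n.+1)%N -> root P (r k) by move=> /rP[].
have r0 k : (k < n.+1)%N -> 0 < r k.
  by move=> /rP[/andP[+ _] _]; apply: lt_trans; exact: node_gt0.
split=> //; first exact: card_roots_family sP rI rr r0.
by move=> u /(all_roots_in_family sP rI rr)[k kn ->]; exact: r0.
Qed.

End Real.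

Theorem lemma1p8 (n : nat) (hn : (2 <= n)%N) (p : nat) (p_pr : prime p)
    (R : realType) :
  [/\ (* eps = 1/4 in the reals *)
      let P := Rpoly (1 / 4 : R) n in
      [/\ size P = n.+2,
          [set u : R | 0 < u /\ root P u] #= `I_n.+1
        & forall u : R, root P u -> real_phase u = 1],
      (* eps = p in Q_p *)
      let P := Rpoly (p%:R : padic p_pr) n in
      [/\ size P = n.+2,
          [set u : padic p_pr | u <> 0 /\ root P u] #= `I_n.+1
        & forall u : padic p_pr, root P u ->
            phase (padic_integers p_pr) p%:R u
            = residue (padic_integers p_pr) p%:R 1]
    & (* eps = t in F_p((t)) *)
      let P := Rpoly (laurentX 'F_p) n in
      [/\ size P = n.+2,
          [set u : laurent 'F_p | u <> 0 /\ root P u] #= `I_n.+1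
        & forall u : laurent 'F_p, root P u ->
            phase (laurent_integers 'F_p) (laurentX 'F_p) u
            = residue (laurent_integers 'F_p) (laurentX 'F_p) 1]].
Proof.
have n0 : (0 < n)%N by exact: ltn_trans hn.
have tofrac_inj (O : idomainType) : injective (@FracField.tofrac O).
  by move=> x y /eqP; rewrite tofrac_eq => /eqP.
split=> P; rewrite {}/P.
- rewrite div1r; have [sP cP rP] := Rpoly_roots_real R hn; split=> // u /rP u0.
  by rewrite /real_phase gtr0_norm // divff // gt_eqF.
(* The parameter must appear as the image of an element of the ring of integers. *)
- rewrite -(rmorph_nat (@FracField.tofrac (padic_int p_pr))).
  by have := @Rpoly_roots_adic _ _ _ _ (tofrac_inj _) (padic_complete p_pr) _ n0.
- by have := @Rpoly_roots_adic _ _ _ _ (tofrac_inj _) (ps_complete 'F_p) _ n0.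
Qed.
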